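(* Let $n\ge1$ and $D\ge1$ be integers, and let $K(n,D)$ be the number of pairwise distinct linear forms in the set $\mathcal{L}(n,D)$ defined in the context (the number of summands, after grouping equal linear forms, in the rational Waring decomposition of a general homogeneous form of degree $D$ in $n+1$ variables obtained by decomposing each of its monomials). Then $$K(n,D)=\sum_{r=1}^{n+1}\left\{\binom{\lfloor\frac{D-r}{2}\rfloor+r}{r}-\binom{\lfloor\frac{D-r}{2}\rfloor}{r}\right\}\cdot 2^{r-1}\cdot\binom{n+1}{r}.$$ In particular, when $n$ is fixed and $D\to\infty$, $$K(n,D)=\frac{n+1}{n!}D^n+O(D^{n-1}).$$
   Context: Fix $t\in\mathbb{Q}\setminus\{0,1,-1\}$. All indices $i$ range over $\{0,\dots,n\}$; ''$i\notin A$'' means $i\in\{0,\dots,n\}\setminus A$. Inclusions are not necessarily strict. For $\mathbf{a}=(a_0,\dots,a_n)\in\mathbb{Z}_{\ge0}^{n+1}$ with $|\mathbf{a}|=\sum_i a_i=D$, put $Z_{\mathbf{a}}=\{i: a_i=0\}$, $E_{\mathbf{a}}=\{i: a_i\text{ is even}\}$, $m_i=\lfloor\frac{a_i-1}{2}\rfloor$. For a set $A\ne\{0,\dots,n\}$ with $Z_{\mathbf{a}}\subset A\subset E_{\mathbf{a}}$, put $$\overline{K_A}=\{(k_i)_{i\notin A}: k_i\in\mathbb{Z},\ 0\le k_i\le m_i\text{ for } i\notin A,\ \min\{k_i\}_{i\notin A}=0\},$$ $$\overline{S_A}=\{(s_i)_{i\notin A}: s_i\in\{0,1\},\ s_{\min\{i:i\notin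 A\}}=0\},$$ and for $\mathbf{k}\in\overline{K_A}$, $\mathbf{s}\in\overline{S_A}$ let $\ell_{A,\mathbf{k},\mathbf{s}}=\sum_{i\notin A}(-1)^{s_i}t^{k_i}X_i\in\mathbb{Q}[X_0,\dots,X_n]$. (The monomial $X_0^{a_0}\cdots X_n^{a_n}$ has an explicit Waring decomposition as a $\mathbb{Q}$-linear combination of the powers $(\ell_{A,\mathbf{k},\mathbf{s}})^D$ over all these $A,\mathbf{k},\mathbf{s}$.) A general homogeneous form of degree $D$ means one in which all monomials of degree $D$ in $X_0,\dots,X_n$ appear; decomposing each monomial $X_0^{a_0}\cdots X_n^{a_n}$ with $|\mathbf{a}|=D$ as a $\mathbb{Q}$-linear combination of the powers $(\ell_{A,\mathbf{k},\mathbf{s}})^D$, over all $A\neq\{0,\dots,n\}$ with $Z_{\mathbf{a}}\subset A\subset E_{\mathbf{a}}$, $\mathbf{k}\in\overline{K_A}$ and $\mathbf{s}\in\overline{S_A}$, uses the linear forms in $$\mathcal{L}(n,D)=\{\ell_{A,\mathbf{k},\mathbf{s}} : \mathbf{a}\in\mathbb{Z}_{\ge0}^{n+1},\ |\mathbf{a}|=D,\ Z_{\mathbf{a}}\subset A\subset E_{\mathbf{a}},\ A\neq\{0,\dots,n\},\ \mathbf{k}\in\overline{K_A},\ \mathbf{s}\in\overline{S_A}\},$$ and $K(n,D)=|\mathcal{L}(n,D)|$. Convention: for integers $m$ and $r\ge1$, $\binom{m}{r}=0$ whenever $m<r$ (in particular for negative $m$). *)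

(* Defs.v *)
From HB Require Import structures.
From mathcomp Require Import all_boot all_order all_algebra.
From mathcomp Require Import finmap mpoly.
From mathcomp Require Import boolp classical_sets functions cardinality.

Set Implicit Arguments.
Unset Strict Implicit.
Unset Printing Implicit Defensive.

Import Order.TTheory GRing.Theory Num.Theory.

Local Open Scope ring_scope.

Definition zero_indices (n : nat) (a : 'X_{1..n.+1}) : {set 'I_n.+1} :=
  [set i | a i == 0%N]%SET.

Definition even_indices (n : nat) (a : 'X_{1..n.+1}) : {set 'I_n.+1} :=
  [set i | ~~ odd (a i)]%SET.

(* Families indexed by the complement of A are total functions on 'I_n.+1
   whose values on A are ignored, both here and in linear_form. *)

(* As Z_a \subset A, i \notin A forces a i > 0, so that (a i).-1./2 is the
   floor of (a i - 1) / 2. The existential says that the minimum of the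
   natural numbers k i, for i \notin A, is 0. *)
Definition exponent_family (n : nat) (a : 'X_{1..n.+1}) (A : {set 'I_n.+1})
    (k : 'I_n.+1 -> nat) : Prop :=
  (forall i, i \notin A -> (k i <= (a i).-1./2)%N) /\
  (exists2 i, i \notin A & k i = 0%N).

(* s i stands for the exponent s_i in {0, 1}, with true for 1. *)
Definition sign_family (n : nat) (A : {set 'I_n.+1})
    (s : 'I_n.+1 -> bool) : Prop :=
  forall i, i \notin A -> (forall j, j \notin A -> (i <= j)%N) -> s i = false.

Definition linear_form (t : rat) (n : nat) (A : {set 'I_n.+1})
    (k : 'I_n.+1 -> nat) (s : 'I_n.+1 -> bool) : {mpoly rat[n.+1]} :=
  \sum_(i | i \notin A) ((-1) ^+ s i * t ^+ k i) *: 'X_i.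

Definition linear_forms (t : rat) (n D : nat) : set {mpoly rat[n.+1]} :=
  fun l => exists (a : 'X_{1..n.+1}) (A : {set 'I_n.+1})
                  (k : 'I_n.+1 -> nat) (s : 'I_n.+1 -> bool),
    [/\ mdeg a = D, zero_indices a \subset A, A \subset even_indices a
      & A != finset.setTfor 'I_n.+1] /\
    [/\ exponent_family a A k, sign_family A s & l = linear_form t A k s].

Arguments linear_forms t n D : clear implicits.

(* fset_set sends an infinite set to fset0; linear_forms t n D is finite, its
   elements being determined by finitely many bounded data. *)
Definition nb_linear_forms (t : rat) (n D : nat) : nat :=
  #|` fset_set (linear_forms t n D)|%fset.

(* 'C(m, r) for m : int and r >= 1, taken to be 0 for m < r. *)
Definition binz (m : int) (r : nat) : int :=
  if m < r%:Z then 0 else 'C(`|m|%N, r)%:Z.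

(* Main.v *)
(* A linear form is determined by its support B = ~: A, its exponents k on B and
   its signs, because |t| is neither 0 nor 1. It occurs exactly when
   |B| + 2 \sum_(i in B) k_i <= D. For |B| = r and N = floor((D - r) / 2) there
   are 'C(N + r, r) families k of sum at most N, of which 'C(N, r) have no zero
   entry (subtract 1 from each entry), and 2 ^ (r - 1) choices of signs.
   For the asymptotics, 'C(N + r, r) - 'C(N, r) = \sum_(j < r) 'C(N + j, r - 1),
   and 2 ^ (r - 1) (r - 1)! 'C(N + j, r - 1) is a product of r - 1 factors
   2 (N + j - i) = D + O(1); hence the r-th term is O(D ^ (r - 1)), and the term
   r = n + 1 gives the leading coefficient. *)
Require Import Defs.
From HB Require Import structures.
From mathcomp Require Import all_boot all_order all_algebra.
From mathcomp Require Import zify ring lra.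

Set Implicit Arguments.
Unset Strict Implicit.
Unset Printing Implicit Defensive.

(** * Counting exponent families of bounded sum *)

(* The ambient bound M only makes the type of k finite. *)
Lemma card_ffun_sum_le (T : finType) (B : {set T}) (M N : nat) :
  N <= M ->
  #|[set k : {ffun T -> 'I_M.+1} | [forall i in ~: B, k i == ord0] &
      \sum_(i in B) k i <= N]| = 'C(#|B| + N, #|B|).
Proof.
move=> leNM; have leSNM : N.+1 <= M.+1 by [].
(* A tuple is read along [enum B]; outside [B] the index runs past its end, so [nth] returns the
   required default 0. *)
pose g (t : #|B|.-tuple 'I_N.+1) : {ffun T -> 'I_M.+1} :=
  [ffun i => widen_ord leSNM (nth ord0 t (index i (enum B)))].
have gK (t : #|B|.-tuple 'I_N.+1) :
    [seq nth ord0 t (index i (enum B)) | i <- enum B] = t.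
  apply: (@eq_from_nth _ ord0) => [|j]; rewrite size_map -cardE ?size_tuple //.
  move=> ltj; have [i0 _] : exists i0, i0 \in B.
    by apply/card_gt0P; apply: leq_ltn_trans ltj.
  by rewrite (nth_map i0) -?cardE // index_uniq ?enum_uniq -?cardE.
rewrite -card_partial_ord_partitions -(@card_in_imset _ _ g); last first.
  move=> t u _ _ eq_tu; apply/val_inj; rewrite /= -[LHS]gK -[RHS]gK.
  apply/eq_map => i; apply/val_inj.
  by move/ffunP/(_ i)/(congr1 val): eq_tu; rewrite !ffunE.
apply/esym/eq_card => k; rewrite inE.
apply/imsetP/andP => [[t] | [/forall_inP k0 lek]].
  rewrite inE => le_t ->; split.
    apply/forall_inP => i; rewrite inE -mem_enum => iB.
    rewrite ffunE; apply/eqP/val_inj.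
    by rewrite /= nth_default // size_tuple cardE memNindex.
  rewrite (leq_trans _ le_t) // -[X in _ <= \sum_(i <- X) _]gK big_map.
  by rewrite [X in _ <= X]big_enum; apply/eq_leq/eq_bigr => i _; rewrite ffunE.
have ltk i : i \in B -> k i < N.+1.
  by move=> iB; rewrite ltnS (leq_trans _ lek) // (bigD1 i) //= leq_addr.
exists [tuple of map (fun i => inord (k i)) (enum_tuple B)].
  rewrite inE big_map big_enum (leq_trans _ lek) //.
  by apply/eq_leq/eq_bigr => i iB; rewrite inordK ?ltk.
apply/ffunP => i; rewrite ffunE; apply/val_inj => /=.
have [iB|iB] := boolP (i \in B); last first.
  rewrite nth_default ?size_map ?memNindex ?mem_enum //.
  by rewrite (eqP (k0 _ _)) ?inE.
by rewrite (nth_map i) ?index_mem ?mem_enum // nth_index ?mem_enum // inordK ?ltk.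
Qed.

(** Adding 1 on [B] maps the families of sum at most [N - #|B|] bijectively onto these. If
    [N < #|B|], there are none. *)
Lemma card_ffun_pos_sum_le (T : finType) (B : {set T}) (M N : nat) :
  N <= M ->
  #|[set k : {ffun T -> 'I_M.+1} | [&& [forall i in ~: B, k i == ord0],
      \sum_(i in B) k i <= N & [forall i in B, 0 < k i]]]| = 'C(N, #|B|).
Proof.
move=> leNM; have [leBN | ltNB] := leqP #|B| N; last first.
  rewrite bin_small //; apply/eqP; rewrite cards_eq0; apply/eqP/setP => k.
  rewrite !inE; apply/negP => /and3P[_ lek /forall_inP k0].
  move: ltNB; rewrite ltnNge (leq_trans _ lek) // -sum1_card.
  by apply: leq_sum => i /k0.
pose g (k : {ffun T -> 'I_M.+1}) : {ffun T -> 'I_M.+1} :=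
  [ffun i => inord (k i + (i \in B))].
rewrite -[N in RHS](subnKC leBN).
rewrite -(card_ffun_sum_le B (leq_trans (leq_subr #|B| N) leNM)).
(* So [inord] in [g] never overflows: if [i] is in [B], then [#|B| >= 1] absorbs the added 1. *)
have ltk (k : {ffun T -> 'I_M.+1}) i : \sum_(i in B) k i <= N - #|B| ->
    k i + (i \in B) < M.+1.
  move=> lek; have [iB|iB] := boolP (i \in B); last by rewrite addn0.
  have B1 : 0 < #|B| by apply/card_gt0P; exists i.
  suff : k i <= \sum_(i in B) k i by lia.
  by rewrite (bigD1 i) //= leq_addr.
rewrite -[RHS](@card_in_imset _ _ g); last first.
  move=> k l; rewrite !inE => /andP[_ lek] /andP[_ lel] eq_kl.
  apply/ffunP => i; apply/val_inj.
  move/ffunP/(_ i)/(congr1 val): eq_kl; rewrite !ffunE /= !inordK ?ltk //.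
  exact: addIn.
apply/eq_card => k; rewrite inE.
apply/and3P/imsetP => [[/forall_inP k0 lek /forall_inP k1] | [l]].
  have kB i : (k i).-1 + (i \in B) = k i.
    have [/k1 ki0|iB] := boolP (i \in B); first by rewrite addn1 prednK.
    by rewrite (eqP (k0 _ _)) ?inE.
  exists [ffun i => inord (k i).-1]; last first.
    apply/ffunP => i; apply/val_inj; rewrite !ffunE /=.
    rewrite [X in inord (X + _)]inordK ?kB ?inord_val //.
    by rewrite (leq_ltn_trans (leq_pred _)).
  have val_pred i : (inord (k i).-1 : 'I_M.+1) = (k i).-1 :> nat.
    by rewrite inordK // (leq_ltn_trans (leq_pred _)).
  rewrite inE; apply/andP; split.
    apply/forall_inP => i /k0 /eqP ki0; rewrite ffunE ki0.
    by apply/eqP/val_inj; rewrite /= inordK.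
  rewrite leq_subRL // addnC -sum1_card -big_split /=.
  rewrite (leq_trans _ lek) //; apply/leq_sum => i iB.
  by rewrite ffunE val_pred -[leqRHS]kB iB.
rewrite inE => /andP[/forall_inP l0 lel] ->; split.
- apply/forall_inP => i iB; rewrite ffunE (eqP (l0 _ iB)).
  by apply/eqP/val_inj; move: iB; rewrite inE => /negPf->; rewrite /= inordK.
- rewrite -(subnK leBN) (leq_trans _ (leq_add lel (leqnn _))) // -sum1_card.
  rewrite -big_split /=.
  by apply/leq_sum => i iB; rewrite ffunE inordK ?ltk // iB.
- by apply/forall_inP => i iB; rewrite ffunE inordK ?ltk // iB addn1.
Qed.

Lemma card_ffun_min0_sum_le (T : finType) (B : {set T}) (M N : nat) :
  N <= M ->
  #|[set k : {ffun T -> 'I_M.+1} | [&& [forall i in ~: B, k i == ord0],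
      \sum_(i in B) k i <= N & [exists i in B, k i == ord0]]]| =
  'C(#|B| + N, #|B|) - 'C(N, #|B|).
Proof.
move=> leNM; rewrite -(card_ffun_pos_sum_le B leNM) -(card_ffun_sum_le B leNM).
rewrite -cardsDS; last by apply/subsetP => k; rewrite !inE => /and3P[-> ->].
apply/eq_card => k; rewrite !inE negb_and.
case: forall_inP => //= _; case: (_ <= N) => //=; rewrite andbT.
rewrite negb_forall; apply: eq_existsb => i.
by rewrite negb_imply -eqn0Ngt.
Qed.

(** * Counting sign choices and encoded forms *)

(** The condition on [S] excludes exactly the minimum of [B], so [S] ranges over the subsets of [B]
    minus that point. *)
Lemma card_subsets_no_min (n : nat) (B : {set 'I_n}) :
  0 < #|B| ->
  #|[set S : {set 'I_n} | S \subset B &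
      [forall i in S, [exists j in B, j < i]]]| = 2 ^ #|B|.-1.
Proof.
case/card_gt0P => i0 i0B; case: (arg_minnP val i0B) => m mB minm.
rewrite (cardsD1 m B) (mB : m \in B) -card_powerset; apply: eq_card => S.
rewrite !inE subsetD1; case: (boolP (S \subset B)) => //= SB.
apply/forall_inP/idP => [SP | mS i iS].
  by apply/negP => /SP/exists_inP[j /minm /=]; rewrite leqNgt => /negPf->.
apply/exists_inP; exists m => //; rewrite ltn_neqAle.
apply/andP; split; last by apply: minm; apply: (subsetP SB).
by apply: contraNneq mS => /val_inj ->.
Qed.

(* Encodes a linear form by B, the complement of A, the exponents k extended by
   0 outside B, and the set S of indices of the negative coefficients. The least
   degree of an admissible a is reached when a i = 2 k_i + 1 on B and a i = 0 on
   A, whence the bound; any excess degree can be put on one element of B. *)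
Definition form_data (n D : nat) :=
  [set x : {set 'I_n} * ({ffun 'I_n -> 'I_D.+1} * {set 'I_n}) | [&& 0 < #|x.1|,
     [&& [forall i in ~: x.1, x.2.1 i == ord0],
         #|x.1| + (\sum_(i in x.1) x.2.1 i).*2 <= D &
         [exists i in x.1, x.2.1 i == ord0]] &
     (x.2.2 \subset x.1) && [forall i in x.2.2, [exists j in x.1, j < i]]]].

(** The guard [r <= D] matters: for [r > D] the truncated [D - r] is 0 and the difference of
    binomials would be 1. *)
Lemma card_form_data (n D : nat) :
  #|form_data n D| =
  \sum_(1 <= r < n.+1)
    (if r <= D then 'C(r + (D - r)./2, r) - 'C((D - r)./2, r) else 0) *
    2 ^ r.-1 * 'C(n, r).
Proof.
pose h r := (if r <= D then 'C(r + (D - r)./2, r) - 'C((D - r)./2, r) else 0) *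
    2 ^ r.-1.
have leBn (B : {set 'I_n}) : #|B| <= n by rewrite -[leqRHS]card_ord max_card.
transitivity (\sum_(B : {set 'I_n} | 0 < #|B|) h #|B|).
  rewrite -sum1_card; under eq_bigl do rewrite inE.
  rewrite -(pair_big_dep (fun B : {set 'I_n} => 0 < #|B|)
    (fun (B : {set 'I_n}) (y : {ffun 'I_n -> 'I_D.+1} * {set 'I_n}) =>
     [&& [forall i in ~: B, y.1 i == ord0],
         #|B| + (\sum_(i in B) y.1 i).*2 <= D &
         [exists i in B, y.1 i == ord0]] &&
     ((y.2 \subset B) && [forall i in y.2, [exists j in B, j < i]]))
    (fun _ _ => 1)) /=.
  apply: eq_bigr => B B0.
  rewrite -(pair_big_dep (fun k : {ffun 'I_n -> 'I_D.+1} =>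
     [&& [forall i in ~: B, k i == ord0],
         #|B| + (\sum_(i in B) k i).*2 <= D &
         [exists i in B, k i == ord0]])
    (fun _ (S : {set 'I_n}) =>
      (S \subset B) && [forall i in S, [exists j in B, j < i]])
    (fun _ _ => 1)) /=.
  under eq_bigr do rewrite sum1dep_card card_subsets_no_min //.
  rewrite sum_nat_const /h; congr (_ * _); case: leqP => leBD.
    rewrite -(@card_ffun_min0_sum_le _ B D); last by lia.
    rewrite cardsE; apply: eq_card => k; rewrite -!topredE /=; congr [&& _, _ & _].
    by move: (\sum_(i in B) k i) => s; lia.
  apply: eq_card0 => k; rewrite -topredE /=; apply/negP => /and3P[_ + _].
  by move: (\sum_(i in B) k i) => s; lia.
(* Group the sets [B] by size; [inord] is faithful as [#|B| <= n], and the class of size 0 is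
   empty. *)
rewrite (partition_big (fun B : {set 'I_n} => inord #|B| : 'I_n.+1) predT) //=.
rewrite big_add1 /= big_mkord [LHS]big_ord_recl big1 ?add0n => [|B]; last first.
  by case/andP=> B0 /eqP/(congr1 val); rewrite /= inordK ?ltnS ?leBn //; lia.
apply: eq_bigr => r _.
rewrite (eq_bigr (fun _ => h r.+1)) => [|B]; last first.
  by move=> /andP[_ /eqP/(congr1 val)]; rewrite /= inordK ?ltnS ?leBn // => ->.
rewrite sum_nat_const mulnC -/(h r.+1); congr (_ * _).
have := card_draws 'I_n r.+1; rewrite card_ord cardsE => <-.
apply: eq_card => B; rewrite -!topredE /= -val_eqE /= inordK ?ltnS ?leBn //.
by rewrite /bump add1n -[eqn _ _]/(_ == _); case: eqP => [->|]; rewrite ?andbF.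
Qed.

From mathcomp Require Import finmap.
From mathcomp Require Import classical_sets cardinality.

Import Order.TTheory GRing.Theory Num.Theory.

(** * Bijection between encoded data and linear forms *)

Section LinearForms.
Import mpoly.

Definition form_of_data (t : rat) (n D : nat)
    (x : {set 'I_n.+1} * ({ffun 'I_n.+1 -> 'I_D.+1} * {set 'I_n.+1})) :=
  linear_form t (~: x.1) (fun i => x.2.1 i) (fun i => i \in x.2.2).

Lemma mcoeff_linear_form (t : rat) (n : nat) (A : {set 'I_n.+1})
    (k : 'I_n.+1 -> nat) (s : 'I_n.+1 -> bool) (j : 'I_n.+1) :
  ((linear_form t A k s)@_U_(j) =
   if j \notin A then (-1) ^+ s j * t ^+ k j else 0)%R.
Proof.
rewrite raddf_sum /=.
rewrite (eq_bigr (fun i => if i == j then (-1) ^+ s i * t ^+ k i else 0))%R.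
  rewrite -big_mkcondr /=; case: ifP => jA; last first.
    by rewrite big1 // => i /andP[+ /eqP ij]; rewrite ij jA.
  rewrite (big_pred1 j) // => i; rewrite andbC /=.
  by case: (i =P j) => [->|//]; rewrite jA.
move=> i _; rewrite mcoeffZ mcoeffXU.
by case: eqP => _; rewrite ?mulr1 ?mulr0.
Qed.

(** Absolute values leave powers of [|t|], which determine the exponent since [|t|] is neither 0 nor
    1; cancelling the power leaves the signs. *)
Lemma signed_exp_inj (t : rat) (s s' : bool) (k k' : nat) :
  (t != 0 -> t != 1 -> t != -1 ->
  (-1) ^+ s * t ^+ k = (-1) ^+ s' * t ^+ k' -> s = s' /\ k = k')%R.
Proof.
move=> t0 t1 tN1 eq_st.
have eq_k : k = k'.
  apply: (@ieexprIn _ `|t|%R).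
  - by rewrite normr_gt0.
  - by rewrite eqr_norml negb_and negb_or t1 tN1.
  - by move/(congr1 Num.norm): eq_st; rewrite !normrMsign !normrX.
split=> //; move: eq_st; rewrite eq_k => /(mulIf (expf_neq0 k' t0)).
by case: s s' => [] [] // /eqP; rewrite -subr_eq0.
Qed.

(** The nonzero coefficients locate [B] and give exponents and signs there; outside [B] the data are
    fixed, [k] being 0 and [S] lying in [B]. *)
Lemma form_of_data_inj (t : rat) (n D : nat) :
  (t != 0 -> t != 1 -> t != -1 ->
   {in form_data n.+1 D &, injective (@form_of_data t n D)})%R.
Proof.
move=> t0 t1 tN1 [B [k S]] [B' [k' S']]; rewrite !inE /=.
case/and3P => _ /and3P[/forall_inP k0 _ _] /andP[/fintype.subsetP SB _].
case/and3P => _ /and3P[/forall_inP k0' _ _] /andP[/fintype.subsetP SB' _] eq_f.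
have eq_c i := congr1 (mcoeff (mnm1 i)) eq_f.
have {eq_f} eqB : B = B'.
  apply/setP => i; have := eq_c i.
  rewrite !mcoeff_linear_form !inE !negbK /=.
  have u0 (b : bool) (m : nat) : ((-1) ^+ b * t ^+ m != 0 :> rat)%R.
    by rewrite mulf_neq0 ?signr_eq0 ?expf_neq0.
  do 2![case: ifP] => // _ _ /eqP; rewrite ?(negPf (u0 _ _)) //.
  by rewrite eq_sym (negPf (u0 _ _)).
rewrite -{B'}eqB in k0' SB' eq_c *.
have eq_B i : i \in B -> (i \in S) = (i \in S') /\ k i = k' i :> nat.
  move=> iB; have := eq_c i; rewrite !mcoeff_linear_form !inE iB /=.
  exact: signed_exp_inj.
congr (_, (_, _)).
  apply/ffunP => i; apply/val_inj; have [/eq_B[] // | iB] := boolP (i \in B).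
  by rewrite (eqP (k0 _ _)) ?(eqP (k0' _ _)) ?inE.
apply/setP => i; have [/eq_B[] // | iB] := boolP (i \in B).
by rewrite (contraNF (SB i)) ?(contraNF (SB' i)).
Qed.

Lemma linear_forms_sub (t : rat) (n D : nat) l :
  linear_forms t n D l ->
  exists2 x, x \in form_data n.+1 D & l = form_of_data t x.
Proof.
case=> a [A [k [s [[degD /fintype.subsetP ZA _ AT] [[kle [i0 i0A ki0]] sP ->]]]]].
have a0 i : i \notin A -> 0 < a i.
  by apply: contraNltn; rewrite leqn0 => ai0; apply: ZA; rewrite inE.
(* For [i] outside [A], [a i > 0] and the bound on [k i] give [2 k i + 1 <= a i]; sum over these
   [i]. *)
have le_sum : #|~: A| + (\sum_(i in ~: A) k i).*2 <= D.
  rewrite -degD mdegE -mul2n big_distrr /= -sum1_card -big_split /=.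
  rewrite [leqRHS](bigID (mem (~: A))) /=; apply: leq_trans (leq_addr _ _).
  by apply: leq_sum => i; rewrite inE => iA; have := a0 i iA; have := kle i iA; lia.
have leD i : i \notin A -> k i < D.+1.
  move=> iA; suff : k i <= \sum_(i in ~: A) k i by lia.
  by rewrite (bigD1 i) ?inE //= leq_addr.
exists (~: A, ([ffun i => if i \in A then ord0 else inord (k i)],
               [set i in ~: A | s i])); last first.
  rewrite /form_of_data /= finset.setCK; apply: eq_bigr => i iA.
  by rewrite ffunE inE inE iA (negPf iA) inordK ?leD.
rewrite inE /=; apply/and3P; split.
- by apply/card_gt0P; exists i0; rewrite inE.
- apply/and3P; split.
  + by apply/forall_inP => i; rewrite finset.setCK ffunE => ->.
  + rewrite (leq_trans _ le_sum) // leq_add2l leq_double.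
    apply/eq_leq/eq_bigr => i; rewrite inE ffunE => iA.
    by rewrite (negPf iA) inordK ?leD.
  + apply/exists_inP; exists i0; rewrite ?inE // ffunE (negPf i0A) ki0.
    by apply/eqP/val_inj; rewrite /= inordK.
- apply/andP; split; first by apply/fintype.subsetP => i; rewrite inE => /andP[].
  apply/forall_inP => i; rewrite inE inE => /andP[iA si].
  apply: contraTT si => /exists_inPn minA; rewrite sP // => j jA.
  by rewrite leqNgt minA ?inE.
Qed.

Lemma form_of_data_linear_forms (t : rat) (n D : nat) x :
  x \in form_data n.+1 D -> linear_forms t n D (form_of_data t x).
Proof.
case: x => B [k S]; rewrite inE /=.
case/and3P => /card_gt0P[i0 i0B] /and3P[_ leD /exists_inP[i1 i1B /eqP ki1]].
case/andP => /fintype.subsetP SB /forall_inP SP.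
pose d := D - (#|B| + (\sum_(i in B) k i).*2).
(* The excess [d] may make the entry at [i0] even, which is harmless: evenness is required only
   outside [B], where the entries are 0. *)
pose F i := if i \in B then ((k i).*2).+1 + d * (i == i0) else 0.
exists (Multinom [tuple F i | i < n.+1]), (~: B), (fun i => k i : nat).
exists (fun i => i \in S); split; split.
- rewrite mdegE; under eq_bigr do rewrite mnmE /F.
  rewrite -big_mkcond /= big_split /= -big_distrr /= [X in d * X](bigD1 i0) //= eqxx.
  rewrite [X in _ * (_ + X)]big1 => [|i /andP[_ /negPf->] //].
  rewrite addn0 muln1; apply: etrans (subnKC leD); congr (_ + _).
  rewrite -sum1_card -mul2n big_distrr -big_split /=.
  by apply: eq_bigr => i _; rewrite mul2n.
- apply/fintype.subsetP => i; rewrite !inE mnmE /F.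
  by case: (i \in B).
- apply/fintype.subsetP => i; rewrite !inE mnmE /F.
  by case: (i \in B).
- by apply/eqP => /setP/(_ i0); rewrite !inE i0B.
- split; last by exists i1; rewrite ?inE ?i1B ?ki1.
  by move=> i; rewrite inE negbK mnmE /F => ->; lia.
- move=> i; rewrite inE negbK => iB minB.
  apply/negP => /SP/exists_inP[j jB].
  by rewrite ltnNge minB // inE jB.
- by [].
Qed.

Lemma nb_linear_formsE (t : rat) (n D : nat) :
  (t != 0 -> t != 1 -> t != -1 -> nb_linear_forms t n D = #|form_data n.+1 D|)%R.
Proof.
move=> t0 t1 tN1; rewrite /nb_linear_forms.
pose s := [seq form_of_data t x | x <- enum (form_data n.+1 D)].
(* Exhibits the set as finite, so that [fset_set] does not take its default value. *)
have -> : linear_forms t n D = [set` [fset y in s]%fset]%classic.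
  apply/seteqP; split => l /=.
    case/linear_forms_sub => x xX ->.
    by rewrite inE; apply: map_f; rewrite mem_enum.
  rewrite inE => /mapP[x]; rewrite mem_enum => xX ->.
  exact: form_of_data_linear_forms.
rewrite set_fsetK card_fseq undup_id ?size_map -?cardE //.
rewrite map_inj_in_uniq ?enum_uniq // => x y; rewrite !mem_enum.
exact: form_of_data_inj.
Qed.

End LinearForms.

From mathcomp Require Import all_classical all_reals all_analysis.

Import numFieldNormedType.Exports.

Local Open Scope classical_set_scope.
Local Open Scope ring_scope.

(** * The closed formula over the integers *)

(** For [r > D] the floor is negative, so both arguments of [binz] are below [r] and both terms
    vanish, matching the guard. *)
Lemma binz_half (D r : nat) : (0 < r)%N ->
  binz (((D%:Z - r%:Z) %/ 2)%Z + r%:Z) r - binz ((D%:Z - r%:Z) %/ 2)%Z r =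
  (if r <= D then 'C(r + (D - r)./2, r) - 'C((D - r)./2, r) else 0)%N%:Z.
Proof.
move=> r0; case: leqP => leD; last first.
  by rewrite /binz !ifT ?subrr //; lia.
have -> : ((D%:Z - r%:Z) %/ 2)%Z = ((D - r)./2)%:Z.
  by rewrite subzn // divz_nat divn2.
have le_bin : ('C((D - r)./2, r) <= 'C(r + (D - r)./2, r))%N.
  by apply: leq_bin2l; rewrite leq_addl.
rewrite -subzn // /binz -PoszD addnC [X in X - _]ifF; last by lia.
by rewrite !absz_nat ltz_nat; case: ltnP => // lt_r; rewrite (bin_small lt_r).
Qed.

(** * Asymptotics *)

(** Pascal's rule, telescoped. *)
Lemma sub_bin_telescope (N p m : nat) :
  ('C(p + N, m.+1) - 'C(N, m.+1) = \sum_(j < p) 'C(N + j, m))%N.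
Proof.
elim: p => [|p IHp]; first by rewrite big_ord0 subnn.
rewrite big_ord_recr /= -IHp addSn binS (addnC N p).
have : ('C(N, m.+1) <= 'C(p + N, m.+1))%N by apply: leq_bin2l; rewrite leq_addl.
lia.
Qed.

(* The factor D on the left avoids the truncated exponent m.-1. *)
Lemma prod_near_expr (R : realFieldType) (m : nat) (c : R) : 0 <= c ->
  exists2 C, 0 <= C & forall (D : R) (x : 'I_m -> R), 1 <= D ->
    (forall i, `|x i - D| <= c) ->
    `|\prod_(i < m) x i - D ^+ m| * D <= C * D ^+ m.
Proof.
move=> c0; elim: m => [|m [C C0 IHm]].
  by exists 0 => // D x _ _; rewrite big_ord0 subrr normr0 !mul0r.
(* With [p] the product of the first [m] factors and [y] the last, split the error as
   [(p - D ^+ m) * y + D ^+ m * (y - D)], where [|y| <= (1 + c) * D]. *)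
exists (C * (1 + c) + c) => [|D x D1 xD].
  by rewrite addr_ge0 ?mulr_ge0 ?addr_ge0.
have D0 : 0 <= D by lra.
have y_le : `|x ord_max| <= (1 + c) * D.
  rewrite -[x _](subrK D) (le_trans (ler_normD _ _)) // (ger0_norm D0).
  have := xD ord_max; nra.
rewrite big_ord_recr /=; set p := \prod_(i < m) _.
have {IHm} : `|p - D ^+ m| * D <= C * D ^+ m by exact: IHm.
move: (xD ord_max) y_le; set y := x _ => yD y_le p_le.
have -> : p * y - D ^+ m.+1 = (p - D ^+ m) * y + D ^+ m * (y - D).
  by rewrite exprSr; ring.
rewrite (le_trans (ler_wpM2r D0 (ler_normD _ _))) // !normrM mulrDl.
rewrite (ger0_norm (exprn_ge0 m D0)) [leRHS]mulrDl; apply: lerD.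
  rewrite mulrAC (le_trans (ler_pM _ _ p_le y_le)) ?mulr_ge0 //.
  by rewrite exprSr le_eqVlt; apply/orP; left; apply/eqP; ring.
by rewrite exprSr -mulrA [leRHS]mulrCA ler_wpM2l ?exprn_ge0 ?ler_wpM2r.
Qed.

Lemma binomial_difference_asymp (R : realFieldType) (m : nat) :
  exists C : R, forall D : nat, (m < D)%N ->
    `|(('C(m.+1 + (D - m.+1)./2, m.+1) - 'C((D - m.+1)./2, m.+1)) * 2 ^ m)%N%:R
       - m.+1%:R / m`!%:R * D%:R ^+ m| * D%:R <= C * D%:R ^+ m.
Proof.
(* The factors are [2 (N + j - i)] with [2 N] equal to [D - m - 1] or [D - m - 2], [j <= m] and
   [i < m]. They stay within [4 (m + 1)] of [D], even when the subtraction truncates, since then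
   [D < 3 m]. *)
have [C C0 hC] := @prod_near_expr R m (4 * m.+1)%:R (ler0n _ _).
exists (\sum_(j < m.+1) C / m`!%:R) => D ltmD.
have m0 : 0 < m`!%:R :> R by rewrite ltr0n fact_gt0.
pose N := ((D - m.+1)./2)%N.
pose x (j i : nat) : R := (2 * (N + j - i))%N%:R.
have bin_x (j : nat) : ('C(N + j, m) * 2 ^ m)%N%:R = (\prod_(i < m) x j i) / m`!%:R.
  apply: (mulIf (lt0r_neq0 m0)); rewrite divfK ?lt0r_neq0 //.
  rewrite -natr_prod big_split /= prod_nat_const card_ord -ffact_prod -bin_ffact.
  by rewrite -natrM mulnAC mulnC.
rewrite sub_bin_telescope -/N big_distrl /= natr_sum.
under eq_bigr do rewrite bin_x.
(* One copy of the limit term for each of the [m + 1] summands of the telescoped difference. *)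
have -> : m.+1%:R / m`!%:R * D%:R ^+ m = \sum_(j < m.+1) D%:R ^+ m / m`!%:R :> R.
  by rewrite sumr_const card_ord -[RHS]mulr_natl mulrAC -mulrA.
rewrite -sumrB (le_trans (ler_wpM2r _ (ler_norm_sum _ _ _))) // !mulr_suml.
apply: ler_sum => j _; rewrite -mulrBl normrM.
rewrite (ger0_norm (x := _^-1)) ?invr_ge0 ?ler0n //.
rewrite mulrAC [leRHS]mulrAC ler_pM2r ?invr_gt0 //.
apply: hC => [|i]; first by rewrite ler1n; lia.
rewrite ler_distl /x -natrD lerBlDr -natrD !ler_nat /N.
by apply/andP; split; case: j i => [j ?] [i ?] /=; lia.
Qed.

Lemma card_form_data_asymp (R : realFieldType) (n : nat) :
  exists C : R, forall D : nat, (n < D)%N ->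
    `|#|form_data n.+1 D|%:R - n.+1%:R / n`!%:R * D%:R ^+ n| * D%:R
    <= C * D%:R ^+ n.
Proof.
pose T m D := (('C(m.+1 + (D - m.+1)./2, m.+1) - 'C((D - m.+1)./2, m.+1)) * 2 ^ m)%N.
have [Cn hCn] := binomial_difference_asymp R n.
(* The term [r = m + 1] with [m < n] has order [D ^ m]; times [D] it is at most a constant times
   [D ^ n], so it belongs to the error. *)
have /choice[C hC] : forall m : 'I_n, exists C : R, forall D : nat, (n < D)%N ->
    (T m D * 'C(n.+1, m.+1))%N%:R * D%:R <= C * D%:R ^+ n.
  move=> m; have [C hC] := binomial_difference_asymp R m.
  exists ((`|C| + m.+1%:R / m`!%:R) * 'C(n.+1, m.+1)%:R) => D ltnD.
  have D1 : 1 <= D%:R :> R by rewrite ler1n; lia.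
  rewrite natrM mulrAC [leRHS]mulrAC ler_wpM2r //.
  have /hC : (m < D)%N by case: m {C hC} => m ltm /=; lia.
  set a := m.+1%:R / m`!%:R; rewrite -/(T m D) => leT.
  have a0 : 0 <= a by rewrite divr_ge0.
  have leX k : (k <= n)%N -> D%:R ^+ k <= D%:R ^+ n :> R.
    by move=> ?; rewrite ler_weXn2l.
  have leX1 := leX _ (ltn_ord m); have leX0 := leX _ (ltnW (ltn_ord m)).
  rewrite -[(T m D)%:R](subrK (a * D%:R ^+ m)) mulrDl [leRHS]mulrDl lerD //.
    apply: le_trans (ler_wpM2r (ler0n _ _) (ler_norm _)) (le_trans leT _).
    apply: le_trans (ler_wpM2r (exprn_ge0 _ (ler0n _ _)) (ler_norm C)) _.
    by rewrite ler_wpM2l.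
  by rewrite -mulrA -exprSr ler_wpM2l.
exists (\sum_m C m + Cn) => D ltnD.
rewrite card_form_data big_add1 /= big_mkord.
(* As [n < D], every guard holds. *)
have -> : (\sum_(i < n.+1)
    (if i < D then 'C(i.+1 + (D - i.+1)./2, i.+1) - 'C((D - i.+1)./2, i.+1) else 0) *
    2 ^ i * 'C(n.+1, i.+1) = \sum_(i < n.+1) T i D * 'C(n.+1, i.+1))%N.
  by apply: eq_bigr => i _; rewrite ifT // (leq_trans (ltn_ord i)).
rewrite big_ord_recr /= binn muln1 natrD -addrA.
rewrite (le_trans (ler_wpM2r (ler0n _ _) (ler_normD _ _))) // !mulrDl lerD ?hCn //.
rewrite ger0_norm // natr_sum !mulr_suml; apply: ler_sum => i _; exact: hC.
Qed.

Theorem theorem3p2 (R : realType) (t : rat) (ht0 : t != 0) (ht1 : t != 1)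
    (htN1 : t != -1) (n : nat) (hn : (1 <= n)%N) :
  (forall D : nat, (1 <= D)%N ->
     (nb_linear_forms t n D)%:Z =
     \sum_(1 <= r < n.+2)
       (binz (((D%:Z - r%:Z) %/ 2)%Z + r%:Z) r - binz ((D%:Z - r%:Z) %/ 2)%Z r)
         * 2 ^+ r.-1 * 'C(n.+1, r)%:Z) /\
  (fun D : nat => (nb_linear_forms t n D)%:R : R^o) =
     (fun D : nat => n.+1%:R / n`!%:R * D%:R ^+ n : R^o)
     +O_\oo (fun D : nat => D%:R ^+ n.-1 : R^o).
Proof.
split=> [D _|].
  rewrite nb_linear_formsE // card_form_data -[LHS]natz natr_sum.
  apply: eq_big_nat => r /andP[r0 _].
  by rewrite binz_half // !natrM natrX !natz.
have [C hC] := card_form_data_asymp R n.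
apply/eqaddOP; near=> k; near=> D.
rewrite !fctE nb_linear_formsE //.
have ltnD : (n < D)%N by near: D; exact: nbhs_infty_gt.
have D0 : 0 < D%:R :> R by rewrite ltr0n; lia.
have leCk : C <= k by near: k; apply: nbhs_pinfty_ge; exact: num_real.
(* Multiplying by [D] turns [D ^ n.-1] into [D ^ n], since [n >= 1], and reduces the goal to
   [C <= k]. *)
rewrite -(ler_pM2r D0) (le_trans (hC _ ltnD)) //.
rewrite ger0_norm ?exprn_ge0 // -mulrA -exprSr prednK // ler_wpM2r ?exprn_ge0.
Unshelve. all: by end_near. Qed.
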